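(* Let $U$, $W_*$, $X$ be normed spaces, $G:U\times X\rightrightarrows W_*$, $J:U\to\mathbb{R}$, $R:X\to(-\infty,\infty]$, and let $S:X\rightrightarrows U$, $S(x)=\{u\in U\mid 0\in G(u,x)\}$; $\mathrm{Sup}_{J\circ S}$ is regarded as a function $X\to(-\infty,\infty]$ (that is, $S$ has nonempty values). Let $\bar x\in X$. Then the pessimistic necessary optimality condition $0\in\partial_F[\mathrm{Sup}_{J\circ S}+R](\bar x)$ holds in each of the following cases: (i) $S$ is inner Lipschitz at $\bar x$ relative to $\{\bar u\}$ for a $\bar u\in S^\flat(\bar x)$, and $$0\in\bigcup_{u^*\in\partial_F J(\bar u)}\widehat D^*S(\bar x|\bar u)(u^* )+\partial_F R(\bar x).$$ (ii) $S$ is inner semi-Lipschitz at $\bar x$ relative to a set $A\subset S^\flat(\bar x)$, and $$0\in\bigcap_{\bar u\in A}\ \bigcup_{u^*\in\partial_F J(\bar u)}\widehat D^*S(\bar x|\bar u)(u^* )+\partial_F R(\bar x).$$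
   Context: $\mathrm{Sup}_{J\circ S}(x)=\sup\{J(u)\mid u\in S(x)\}$ and $S^\flat(x)=\{u\in S(x)\mid J(u)=\mathrm{Sup}_{J\circ S}(x)\}$. Fréchet subdifferential of $F:X\to(-\infty,\infty]$ at $x$ with $F(x)$ finite (empty if $F(x)=\infty$): $\partial_F F(x)=\{x^*\in X^*\mid \liminf_{\tilde x\to x}\frac{F(\tilde x)-F(x)-\langle x^*|\tilde x-x\rangle}{\|\tilde x-x\|}\ge 0\}$; likewise $\partial_F J(u)\subset U^*$. Fréchet coderivative of $F:X\rightrightarrows Y$ at $x$ for $y$: for $y^*\in Y^*$, $$\widehat D^*F(x|y)(y^* )=\Bigl\{x^*\in X^*\Bigm| \limsup_{\tilde x\to x,\ F(\tilde x)\ni\tilde y\to y}\frac{\langle x^*|\tilde x-x\rangle-\langle y^*|\tilde y-y\rangle}{\|\tilde x-x\|+\|\tilde y-y\|}\le 0\Bigr\}.$$ $\mathrm{dom}\,F=\{x\mid F(x)\neq\emptyset\}$ for set-valued $F$; $\mathrm{dist}(B,a)=\inf_{b\in B}\|a-b\|$. $F:X\rightrightarrows Y$ is inner Lipschitz at $x$ relative to $A\subset Y$ if for every $y\in A$ there exist $\lambda_y\ge0$ and $\rho_y>0$ with $\mathrm{dist}(F(\tilde x),y)\le\lambda_y\|x-\tilde x\|$ for all $\tilde x\in B(x,\rho_y)\cap\mathrm{dom}\,F$. It is inner semi-Lipschitz at $x$ relative to $A$ if, for every sequence $\mathrm{dom}\,F\ni x^k\to x$, there exist a subsequence (not relabelled),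 some $y\in A$, and $\lambda_y\ge 0$ with $\mathrm{dist}(F(x^k),y)\le\lambda_y\|x-x^k\|$ for all $k$. *)

(* Defs.v *)
From HB Require Import structures.
From mathcomp Require Import all_boot all_order all_algebra.
From mathcomp Require Import all_classical all_reals all_analysis.
Set Implicit Arguments.
Unset Strict Implicit.
Unset Printing Implicit Defensive.

Import Order.TTheory GRing.Theory Num.Theory.
Import numFieldNormedType.Exports.
Local Open Scope classical_set_scope.
Local Open Scope ring_scope.

Section Defs.
Context {K : realType}.

(* X^*, inside the zmodType X -> K, so that 0 and sums are pointwise. *)
Definition dual (X : normedModType K) : set (X -> K) :=
  [set f : X -> K | scalar f /\ continuous f].

Definition minkowski_sum (V : zmodType) (A B : set V) : set V :=
  [set a + b | a in A & b in B].

(* F takes values in \bar K; it is meant to avoid -oo. The liminf is over the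
   deleted neighbourhoods of x, where the quotient makes sense; on the trivial
   space this filter contains set0 and the liminf is +oo. *)
Definition frechet_subdiff (X : normedModType K) (F : X -> \bar K) (x : X) :
    set (X -> K) :=
  [set xs | [/\ dual xs, F x \is a fin_num &
     (0 <= limf_einf
        (fun x' : X => (F x' - F x - (xs (x' - x))%:E) * (`|x' - x|^-1)%:E)
        x^')%E]].

(* The limsup ranges over the points of the graph of F tending to (x, y) and
   different from (x, y); it is -oo if there are none near (x, y). *)
Definition frechet_coderiv (X Y : normedModType K) (F : X -> set Y)
    (x : X) (y : Y) (ys : Y -> K) : set (X -> K) :=
  [set xs | dual xs /\
     (limf_esup
        (fun p : X * Y => ((xs (p.1 - x) - ys (p.2 - y)) /
                           (`|p.1 - x| + `|p.2 - y|))%:E)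
        (within [set p | F p.1 p.2] (x, y)^') <= 0)%E].

Definition svdom (X Y : Type) (F : X -> set Y) : set X := [set x | F x !=set0].

(* \bar K-valued: the distance to the empty set is +oo. *)
Definition dist (Y : normedModType K) (B : set Y) (a : Y) : \bar K :=
  ereal_inf [set `|a - b|%:E | b in B].

Definition inner_lipschitz (X Y : normedModType K) (F : X -> set Y)
    (x : X) (A : set Y) : Prop :=
  forall y, A y -> exists lambda rho : K, [/\ 0 <= lambda, 0 < rho &
    forall x', (ball x rho `&` svdom F) x' ->
      (dist (F x') y <= (lambda * `|x - x'|)%:E)%E].

Definition inner_semi_lipschitz (X Y : normedModType K) (F : X -> set Y)
    (x : X) (A : set Y) : Prop :=
  forall xk : nat -> X, (forall k, svdom F (xk k)) -> xk k @[k --> \oo] --> x ->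
    exists phi : nat -> nat, {homo phi : m n / (m < n)%N} /\
    exists y, A y /\ exists lambda : K, 0 <= lambda /\
      forall k, (dist (F (xk (phi k))) y <= (lambda * `|x - xk (phi k)|)%:E)%E.

Definition solution_map (U X W : normedModType K) (G : U * X -> set W) :
    X -> set U :=
  fun x => [set u | G (u, x) 0].

Definition sup_over (U X : normedModType K) (J : U -> K) (S : X -> set U)
    (x : X) : \bar K :=
  ereal_sup [set (J u)%:E | u in S x].

Definition argsup (U X : normedModType K) (J : U -> K) (S : X -> set U)
    (x : X) : set U :=
  [set u | S x u /\ (J u)%:E = sup_over J S x].

End Defs.

(* Main.v *)
(* Case (i) is case (ii) for the set A = {ubar}: a sequence converging to xbar
   is eventually in the ball of the inner Lipschitz condition, hence has a tail
   satisfying the inner semi-Lipschitz one.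

   For (ii), the key estimate is local: fix ubar in A, a slope us of J at ubar,
   xs in the coderivative at us, and zs = - xs in the subdifferential of R. If
   dist (S x') ubar <= lambda |x' - xbar| with x' <> xbar near xbar, there is
   u' in S x' with |u' - ubar| <= (lambda + 1) |x' - xbar|, and then, up to
   errors that are o(|x' - xbar|),
     Sup x' >= J u' >= J ubar + us (u' - ubar) >= Sup xbar + xs (x' - xbar),
   so that (Sup + R) x' >= (Sup + R) xbar. Points violating the optimality
   condition would form a sequence tending to xbar, along a subsequence of which
   the local estimate applies for some ubar in A. *)
Require Import Defs.
From HB Require Import structures.
From mathcomp Require Import all_boot all_order all_algebra.
From mathcomp Require Import all_classical all_reals all_analysis.
From mathcomp Require Import lra.
Set Implicit Arguments.
Unset Strict Implicit.

Import Order.TTheory GRing.Theory Num.Theory.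
Import numFieldNormedType.Exports.
Local Open Scope classical_set_scope.
Local Open Scope ring_scope.

(** The liminf is the supremum, over the members of [F], of the infima of [f]; any [- e < 0] lies
    strictly below a nonnegative supremum, so some member witnesses it. *)
Lemma limf_einf_ge0P (K : realType) (T : choiceType) (X : filteredType T)
    (f : X -> \bar K) (F : set_system X) (FF : Filter F) :
  (0 <= limf_einf f F)%E <->
  (forall e, 0 < e -> \forall x \near F, ((- e)%:E <= f x)%E).
Proof.
rewrite limf_einfE; split=> [f0 e e0|fF].
  have : ((- e)%:E < ereal_sup [set ereal_inf (f @` V) | V in F])%E.
    by apply: lt_le_trans f0; rewrite lte_fin oppr_lt0.
  move=> /ereal_sup_gt[_ [V FV <-]] eV; apply: filterS FV => x Vx.
  by apply: (le_trans (ltW eV)); apply: ereal_inf_lbound; exists x.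
apply/lee_addgt0Pr => e e0.
rewrite -leeBlDr// sub0e; apply: ereal_sup_ge; eexists.
  by eexists; [exact: fF e0|reflexivity].
by apply: le_ereal_inf_tmp => _ [x /= ? <-].
Qed.

Lemma limf_esup_le0P (K : realType) (T : choiceType) (X : filteredType T)
    (f : X -> \bar K) (F : set_system X) (FF : Filter F) :
  (limf_esup f F <= 0)%E <->
  (forall e, 0 < e -> \forall x \near F, (f x <= e%:E)%E).
Proof.
rewrite -[limf_esup f F]oppeK -limf_einfN oppe_le0 limf_einf_ge0P.
by split=> fF e /fF; apply: filterS => x; rewrite EFinN leeN2.
Qed.

Lemma dual0 (K : realType) (X : normedModType K) (f : X -> K) :
  dual f -> f 0 = 0.
Proof.
by case=> lf _; have := lf (-1) 0 0; rewrite scaler0 addr0 mulN1r addNr.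
Qed.

(** Only [a] has to be finite for it to change sides, so [b] may be infinite, as values of [R] may
    be. *)
Lemma lee_difference_quotient (K : realType) (a b : \bar K) (c n e : K) :
  a \is a fin_num -> 0 < n ->
  ((- e)%:E <= (b - a - c%:E) * (n^-1)%:E)%E = (a + (c - e * n)%:E <= b)%E.
Proof.
move=> a_fin n0; rewrite -lee_pdivrMr ?invr_gt0// invrK -EFinM.
by rewrite leeBrDr// leeBrDr// addeC -EFinD [(_ + c)%R]addrC mulNr.
Qed.

(** Once the denominator is cleared, the inequality is an equality at [x' = x], so the deleted
    neighbourhood can be replaced by a full one. *)
Lemma frechet_subdiffP (K : realType) (X : normedModType K) (F : X -> \bar K)
    (x : X) (xs : X -> K) :
  frechet_subdiff F x xs <->
  [/\ dual xs, F x \is a fin_num & forall e, 0 < e -> \forall x' \near x,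
    (F x + (xs (x' - x) - e * `|x' - x|)%:E <= F x')%E].
Proof.
have norm_neq x' : x' != x -> 0 < `|x' - x| by rewrite normr_gt0 subr_eq0.
split=> -[xsX Fx H]; split=> //.
  move/limf_einf_ge0P : H => H e /H; rewrite near_withinE; apply: filterS.
  move=> x' H'; have [->|xx'] := eqVneq x' x.
    by rewrite subrr (dual0 xsX) normr0 mulr0 subr0 adde0.
  by rewrite -lee_difference_quotient ?norm_neq//; exact: H'.
apply/limf_einf_ge0P => e /H; rewrite near_withinE; apply: filterS => x' H' xx'.
by rewrite lee_difference_quotient ?norm_neq.
Qed.

Lemma frechet_coderiv_near (K : realType) (X Y : normedModType K)
    (F : X -> set Y) (x : X) (y : Y) (ys : Y -> K) (xs : X -> K) :
  dual ys -> frechet_coderiv F x y ys xs ->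
  forall e, 0 < e -> \forall p \near (x, y), F p.1 p.2 ->
    xs (p.1 - x) - ys (p.2 - y) <= e * (`|p.1 - x| + `|p.2 - y|).
Proof.
move=> /dual0 ys0 [/dual0 xs0 /limf_esup_le0P H] e /H.
rewrite near_withinE /dnbhs near_withinE; apply: filterS => -[x' y'] /= H' Fp.
have [[-> ->]|pxy] := eqVneq (x', y') (x, y).
  by rewrite !subrr xs0 ys0 subrr !normr0 addr0 mulr0.
have n0 : 0 < `|x' - x| + `|y' - y|.
  rewrite lt_def addr_ge0// andbT paddr_eq0// !normr_eq0 !subr_eq0.
  by apply: contra pxy => /andP[/eqP-> /eqP->].
by move: (H' pxy Fp); rewrite lee_fin ler_pdivrMr.
Qed.

Lemma not_near_seq (K : realType) (X : normedModType K) (x : X) (P : set X) :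
  ~ (\forall x' \near x, P x') ->
  exists2 xk : nat -> X, xk @ \oo --> x & forall k, ~ P (xk k).
Proof.
move=> nP.
have /choice[xk xkP] : forall k : nat, exists y,
    ball x (k.+1%:R^-1 : K) y /\ ~ P y.
  move=> k; apply: contrapT => /forallNP H; apply: nP.
  have k0 : 0 < (k.+1%:R^-1 : K) by rewrite invr_gt0.
  apply: filterS (near_ball x _ k0) => y xy.
  by apply: contrapT => nPy; apply: (H y).
exists xk; last by move=> k; case: (xkP k).
apply/cvgrPdist_lt => e e0.
near=> k; case: (xkP k) => + _; rewrite -ball_normE /= => /lt_trans; apply.
near: k; apply: filterS (near_infty_natSinv_lt (PosNum e0)) => k //.
Unshelve. all: by end_near. Qed.

Lemma cvg_homo_subseq (T : topologicalType) (u : nat -> T) (l : T)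
    (phi : nat -> nat) :
  {homo phi : m n / (m < n)%N} -> u @ \oo --> l -> u \o phi @ \oo --> l.
Proof.
move=> phi_lt; apply: cvg_comp; apply/cvgnyPge => N.
exists N => // n /= /leq_trans; apply.
(* A strictly increasing [phi] satisfies [n <= phi n]. *)
by elim: n => // n /leq_ltn_trans; apply; exact: phi_lt.
Qed.

Lemma inner_lipschitz_semi (K : realType) (X Y : normedModType K)
    (F : X -> set Y) (x : X) (y : Y) :
  inner_lipschitz F x [set y] -> inner_semi_lipschitz F x [set y].
Proof.
move=> /(_ y erefl)[lambda [rho [l0 rho0 H]]] xk xkF.
move=> /cvg_ballP/(_ _ rho0)[N _ HN].
exists (addn N); split; first by move=> m n; rewrite ltn_add2l.
exists y; split=> //; exists lambda; split=> // k; apply: H; split=> //.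
by apply: HN => /=; rewrite leq_addr.
Qed.

Lemma dist_exists (K : realType) (Y : normedModType K) (B : set Y) (a : Y)
    (r : K) : (dist B a < r%:E)%E -> exists2 b, B b & `|b - a| < r.
Proof.
move=> /ereal_inf_lt[_ [b Bb <-]]; rewrite lte_fin distrC.
by exists b.
Qed.

Lemma sup_over_local_estimate (K : realType) (U X : normedModType K)
    (J : U -> K) (S : X -> set U) (R : X -> \bar K) (x : X) (u : U)
    (us : U -> K) (xs zs : X -> K) (lambda e : K) :
  argsup J S x u -> frechet_subdiff (EFin \o J) u us ->
  frechet_coderiv S x u us xs -> frechet_subdiff R x zs -> xs + zs = 0 ->
  0 <= lambda -> 0 < e ->
  \forall x' \near x, (dist (S x') u <= (lambda * `|x - x'|)%:E)%E ->
    (sup_over J S x + R x - (e * `|x' - x|)%:E <= sup_over J S x' + R x')%E.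
Proof.
move=> [Sxu Ju] /frechet_subdiffP[us_dual _ HJ] xs_coderiv.
move=> /frechet_subdiffP[_ Rx HR] xszs l0 e0.
(* With [n = |x' - x|] and [|u' - u| <= (lambda + 1) n], the errors from [R], [J] and the
   coderivative add up to at most [d (2 n + 2 (lambda + 1) n) = e n]. *)
pose d := e / (2 * lambda + 4).
have d0 : 0 < d by apply: divr_gt0 => //; lra.
have de : d * (2 * lambda + 4) = e by rewrite /d mulfVK//; apply/eqP; lra.
have : \forall p \near (x, u),
    [/\ (R x + (zs (p.1 - x) - d * `|p.1 - x|)%:E <= R p.1)%E,
        J u + (us (p.2 - u) - d * `|p.2 - u|) <= J p.2 &
        S p.1 p.2 -> xs (p.1 - x) - us (p.2 - u) <=
          d * (`|p.1 - x| + `|p.2 - u|)].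
  have cod := frechet_coderiv_near us_dual xs_coderiv d0.
  near=> p; split.
  - by near: p; apply: (cvg_fst (HR _ d0)).
  - by rewrite -lee_fin; near: p; apply: (cvg_snd (HJ _ d0)).
  - by near: p; exact: cod.
move=> /nbhs_ballP[r /= r0 Hr].
(* This radius keeps both [x'] and the point [u'] chosen below within [r] of [x] and [u]. *)
have r'0 : 0 < r / (lambda + 1) by apply: divr_gt0 => //; lra.
apply: filterS (near_ball x _ r'0) => x'; rewrite -ball_normE /= => xx' dS.
have [->|neq] := eqVneq x' x.
  by rewrite subrr normr0 mulr0 sube0.
have n0 : 0 < `|x' - x| by rewrite normr_gt0 subr_eq0.
(* The distance need not be attained; as [x' <> x], raising [lambda] to [lambda + 1] makes the bound
   strict. *)
have [|u' Su' uu'] := @dist_exists _ _ (S x') u ((lambda + 1) * `|x' - x|).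
  apply: le_lt_trans dS _; rewrite distrC lte_fin; nra.
have lt1 : (lambda + 1) * `|x' - x| < r.
  by move: xx'; rewrite distrC ltr_pdivlMr ?[_ * (_ + 1)]mulrC//; lra.
have [|HR' HJ' /(_ Su') Hc] := Hr (x', u').
  split; rewrite /= -ball_normE /= distrC; last by lra.
  by apply: le_lt_trans lt1; nra.
have zsE : zs (x' - x) = - xs (x' - x).
  apply/eqP; rewrite -addr_eq0 addrC; apply/eqP.
  exact: (congr1 (@^~ (x' - x)) xszs).
rewrite /= {}zsE in HR' HJ' Hc.
apply: le_trans (leeD (ereal_sup_ubound _) HR'); last by exists u'.
rewrite -Ju -(fineK Rx) -!EFinD lee_fin -de; nra.
Unshelve. all: by end_near. Qed.

Lemma pessimistic_semi_lipschitz (K : realType) (U X : normedModType K)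
    (J : U -> K) (S : X -> set U) (R : X -> \bar K) (x : X) (A : set U) :
  (forall x', S x' !=set0) -> A `<=` argsup J S x ->
  inner_semi_lipschitz S x A ->
  minkowski_sum
    (\bigcap_(u in A) \bigcup_(us in frechet_subdiff (EFin \o J) u)
       frechet_coderiv S x u us)
    (frechet_subdiff R x) 0 ->
  frechet_subdiff (sup_over J S \+ R)%E x 0.
Proof.
move=> hS AS lipS [xs xsA [zs zsR xszs]].
apply/frechet_subdiffP; split.
- split; first by move=> a v w; rewrite /= mulr0 addr0.
  exact: cst_continuous.
(* The constant sequence yields a point of [A], so the supremum at [x] is a value of [J], hence
   finite. *)
- have [|phi [_ [u [Au _]]]] := lipS (fun=> x) (fun=> hS x).
    exact: cvg_cst.
  have [_ <-] := AS _ Au.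
  by move/frechet_subdiffP: zsR => [_ Rx _]; rewrite fin_numD Rx andbT.
move=> e e0; apply: contrapT => /not_near_seq[xk xkx xkN].
have [phi [phi_lt [u [Au [lambda [l0 phiS]]]]]] := lipS xk (fun=> hS _) xkx.
have [us usJ xs_coderiv] := xsA u Au.
have := sup_over_local_estimate (AS _ Au) usJ xs_coderiv
  zsR xszs l0 e0.
(* A single late index of the subsequence already contradicts [xkN]. *)
move=> /(cvg_homo_subseq phi_lt xkx)[N _ /(_ N (leqnn N))] /= H.
by apply: (xkN (phi N)); rewrite /= sub0r EFinN; apply: H; exact: phiS.
Qed.

Unset Implicit Arguments.
Set Strict Implicit.

Theorem theorem3p3 (K : realType) (U W X : normedModType K)
    (G : U * X -> set W) (J : U -> K) (R : X -> \bar K)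
    (hR : forall x, R x != -oo%E)
    (hS : forall x, solution_map G x !=set0)
    (xbar : X) :
  let S := solution_map G in
  ((exists ubar : U,
      [/\ argsup J S xbar ubar,
          inner_lipschitz S xbar [set ubar] &
          minkowski_sum
            (\bigcup_(us in frechet_subdiff (EFin \o J) ubar)
               frechet_coderiv S xbar ubar us)
            (frechet_subdiff R xbar) 0]) ->
   frechet_subdiff (sup_over J S \+ R)%E xbar 0)
  /\
  (forall A : set U, A `<=` argsup J S xbar ->
     inner_semi_lipschitz S xbar A ->
     minkowski_sum
       (\bigcap_(ubar in A)
          \bigcup_(us in frechet_subdiff (EFin \o J) ubar)
            frechet_coderiv S xbar ubar us)
       (frechet_subdiff R xbar) 0 ->
   frechet_subdiff (sup_over J S \+ R)%E xbar 0).
Proof.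
split=> [[ubar [ubarS lipS opt]]|A AS lipS opt].
  apply: (@pessimistic_semi_lipschitz _ _ _ _ _ _ _ [set ubar]) => //.
  - by move=> _ ->.
  - exact: inner_lipschitz_semi.
  - by rewrite bigcap_set1.
exact: pessimistic_semi_lipschitz opt.
Qed.
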